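(* Every 2space$^\star$ is of the form $S(\mathbf L)$ for some De Morgan bisemilattice $\mathbf L$, that is, it is isomorphic, as a 2space$^\star$, to $S(\mathbf L)$.
   Context: **Bisemilattices.** A De Morgan bisemilattice is an algebra $\langle A,\land,\lor,',0,1\rangle$ such that: - $\land,\lor$ are idempotent, commutative and associative, and each distributes over the other; - $x\land1=x$, $x\lor0=x$, $x''=x$, $(x\land y)'=x'\lor y'$ and $(x\lor y)'=x'\land y'$. Write $a\le_\land b$ iff $a\land b=a$, and $a\le_\lor b$ iff $a\lor b=b$. Filters are nonempty subsets upward closed for $\le_\land$ and closed under $\land$; ideals are nonempty subsets downward closed for $\le_\lor$ and closed under $\lor$. **Fspaces.** An Fspace is a Stone space $X$ with a partial order $\le$ such that: (1) every subset has a greatest lower bound; (2) there is a clopen subbasis $\{X_i\}\cup\{\overline X_i\}$, where $X_i=\{x:x_i\le x\}$ for points $x_i$ and $\overline X_i=X\setminus X_i$; (3) every $x$ is the least upper bound of $\{x_i:x_i\le x\}$; (4) $X^*=\{X_i\}$ is closed under finite intersections. Put $\overline X^*=\{\overline X_i\}$. **2spaces and 2spaces$^\star$.** A 2space $\langle X,\rho,Y\rangle$ consists of: - Fspaces $X,Y$ with subbases $\{X_a\}\cup\{\overline X_a\}$ and $\{Y_a\}\cup\{\overline Y_a\}$ over a common index set; - a bijection $\rho:X^*\to\overline Y^*$ with $\rho(X_a)=\overline Y_a$, satisfying $P\cap\rho^{-1}(\rho(Q)\cup\rho(R))=\rho^{-1}(\rho(P\cap Q)\cup\rho(P\cap R))$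 for $P,Q,R\in X^*$, and $P\cup\rho(\rho^{-1}(Q)\cap\rho^{-1}(R))=\rho(\rho^{-1}(P\cup Q)\cap\rho^{-1}(P\cup R))$ for $P,Q,R\in\overline Y^*$. A 2space$^\star$ additionally has an inclusion-reversing order isomorphism ${}^\star:\overline Y^*\to X^*$ with ${}^\star\circ\rho=\rho^{-1}\circ({}^\star)^{-1}$, and $\overline Y^*$ has a least element $\overline0$. **$S(\mathbf L)$.** For a De Morgan bisemilattice $\mathbf L$, $S(\mathbf L)=\langle\mathcal F(L),\rho,{}^\star,\mathcal I(L)\rangle$, where: - filters and ideals are ordered by inclusion; - the subbases are $X_a=\{F:a\in F\}$, $Y_a=\{I:a\in I\}$ and their complements; - $\rho(X_a)=\overline Y_a$, $(\overline Y_a)^\star=X_{a'}$ and $\overline0=\overline Y_0$. *)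

(* Defs.v *)
From HB Require Import structures.
From mathcomp Require Import all_boot all_order.
From mathcomp Require Import all_classical topology.

Set Implicit Arguments.
Unset Strict Implicit.
Unset Printing Implicit Defensive.

Import Order.TTheory.
Local Open Scope order_scope.
Local Open Scope classical_set_scope.

Record deMorganBisemilattice := DeMorganBisemilattice {
  bcarrier :> Type;
  bmeet : bcarrier -> bcarrier -> bcarrier;
  bjoin : bcarrier -> bcarrier -> bcarrier;
  bneg : bcarrier -> bcarrier;
  bzero : bcarrier;
  bone : bcarrier;
  bmeetxx : idempotent_op bmeet;
  bjoinxx : idempotent_op bjoin;
  bmeetC : commutative bmeet;
  bjoinC : commutative bjoin;
  bmeetA : associative bmeet;
  bjoinA : associative bjoin;
  bmeet_joinr : right_distributive bmeet bjoin;
  bjoin_meetr : right_distributive bjoin bmeet;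
  bmeetx1 : right_id bone bmeet;
  bjoinx0 : right_id bzero bjoin;
  bnegK : involutive bneg;
  bneg_meet : {morph bneg : x y / bmeet x y >-> bjoin x y};
  bneg_join : {morph bneg : x y / bjoin x y >-> bmeet x y}
}.

(* A subbasis of the topology of X: the open sets are exactly the unions of
   finite intersections (the empty one included) of members of S. *)
Definition is_subbasis (X : topologicalType) (S : set (set X)) : Prop :=
  @open X = [set \bigcup_(V in B) V | B in subset^~ (finI_from S id)].

Definition stone_space (X : topologicalType) : Prop :=
  [/\ compact [set: X], hausdorff_space X & totally_disconnected [set: X]].

Section Fspace.
Context {d : Order.disp_t} {X : POrderedTopological.type d} {I : Type}.
Variable x_ : I -> X.

Definition cone (i : I) : set X := [set x | x_ i <= x].
Definition cones : set (set X) := range cone.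
Definition cocones : set (set X) := range (setC \o cone).

(* [finI_from cones id] contains the empty intersection, so the last field
   includes [setT] being a cone. *)
Record is_fspace : Prop := IsFspace {
  fspace_stone : stone_space X;
  fspace_glb : forall A : set X, infimums A !=set0;
  fspace_clopen : forall i, clopen (cone i);
  fspace_subbasis : is_subbasis (cones `|` cocones);
  fspace_lub : forall x, supremums (x_ @` [set i | x_ i <= x]) x;
  fspace_finI : finI_from cones id `<=` cones
}.

End Fspace.

(* The map rho is a total function on sets, of which only the values on the
   cones of X are meaningful; the same applies to the map star below. *)
Record twospace_data := TwospaceData {
  tIdx : Type;
  tdX : Order.disp_t;
  tdY : Order.disp_t;
  tX : POrderedTopological.type tdX;
  tY : POrderedTopological.type tdY;
  tx : tIdx -> tX;
  ty : tIdx -> tY;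
  trho : set tX -> set tY
}.

Arguments tx : clear implicits.
Arguments ty : clear implicits.
Arguments trho : clear implicits.

Section Twospace.
Variable W : twospace_data.

Definition Xstar : set (set (tX W)) := cones (tx W).
Definition coYstar : set (set (tY W)) := cocones (ty W).

Local Notation rho := (trho W).

Definition rhoV : set (tY W) -> set (tX W) := 'pinv_(fun=> set0) Xstar rho.

Record is_twospace : Prop := IsTwospace {
  twospace_X : is_fspace (tx W);
  twospace_Y : is_fspace (ty W);
  twospace_bij : set_bij Xstar coYstar rho;
  twospace_rho : forall i, rho (cone (tx W) i) = ~` cone (ty W) i;
  twospace_meet : forall P Q R, Xstar P -> Xstar Q -> Xstar R ->
    P `&` rhoV (rho Q `|` rho R) = rhoV (rho (P `&` Q) `|` rho (P `&` R));
  twospace_join : forall P Q R, coYstar P -> coYstar Q -> coYstar R ->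
    P `|` rho (rhoV Q `&` rhoV R) = rho (rhoV (P `|` Q) `&` rhoV (P `|` R))
}.

End Twospace.

Arguments Xstar : clear implicits.
Arguments coYstar : clear implicits.

Record twospace_star_data := TwospaceStarData {
  tbase :> twospace_data;
  tstar : set (tY tbase) -> set (tX tbase);
  tzero : set (tY tbase)
}.

Arguments tstar : clear implicits.
Arguments tzero : clear implicits.

Section TwospaceStar.
Variable W : twospace_star_data.

Local Notation rho := (trho W).
Local Notation star := (tstar W).

Definition starV : set (tX W) -> set (tY W) :=
  'pinv_(fun=> set0) (coYstar W) star.

Record is_twospace_star : Prop := IsTwospaceStar {
  star_twospace : is_twospace W;
  star_bij : set_bij (coYstar W) (Xstar W) star;
  star_anti : forall P Q, coYstar W P -> coYstar W Q ->
    star P `<=` star Q <-> Q `<=` P;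
  star_rho : forall P, Xstar W P -> star (rho P) = rhoV (starV P);
  star_zero : coYstar W (tzero W);
  star_zero_le : forall Q, coYstar W Q -> tzero W `<=` Q
}.

End TwospaceStar.

Definition order_homeo d d' (X : POrderedTopological.type d)
    (X' : POrderedTopological.type d') (f : X -> X') : Prop :=
  [/\ {mono f : x y / x <= y}, continuous f &
    exists g : X' -> X, [/\ cancel f g, cancel g f & continuous g]].

(* Isomorphisms preserve the families of distinguished sets and the maps
   between them, not the way these families are indexed. *)
Record is_twospace_star_iso (V W : twospace_star_data)
    (f : tX V -> tX W) (g : tY V -> tY W) : Prop := IsTwospaceStarIso {
  iso_X : order_homeo f;
  iso_Y : order_homeo g;
  iso_Xstar : [set f @` P | P in Xstar V] = Xstar W;
  iso_coYstar : [set g @` Q | Q in coYstar V] = coYstar W;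
  iso_rho : forall P, Xstar V P -> trho W (f @` P) = g @` trho V P;
  iso_star : forall Q, coYstar V Q -> tstar W (g @` Q) = f @` tstar V Q;
  iso_zero : g @` tzero V = tzero W
}.

Definition twospace_star_isomorphic (V W : twospace_star_data) : Prop :=
  exists (f : tX V -> tX W) (g : tY V -> tY W), is_twospace_star_iso f g.

Section Spaces.
Variable L : deMorganBisemilattice.
Implicit Types a b : L.

Definition le_meet a b : Prop := bmeet a b = a.
Definition le_join a b : Prop := bjoin a b = b.

Definition filters : set (set L) := [set F | [/\ F !=set0,
  forall a b, F a -> le_meet a b -> F b &
  forall a b, F a -> F b -> F (bmeet a b)]].

Definition ideals : set (set L) := [set J | [/\ J !=set0,
  forall a b, J b -> le_join a b -> J a &
  forall a b, J a -> J b -> J (bjoin a b)]].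

Definition filter_space := set_type filters.
Definition ideal_space := set_type ideals.

HB.instance Definition _ := SubChoice.on filter_space.
HB.instance Definition _ := SubChoice.on ideal_space.
HB.instance Definition _ :=
  [SubChoice_isSubPOrder of filter_space by <: with set_display].
HB.instance Definition _ :=
  [SubChoice_isSubPOrder of ideal_space by <: with set_display].

Definition X_ a : set filter_space := [set F | set_val F a].
Definition Y_ a : set ideal_space := [set J | set_val J a].

HB.instance Definition _ := isSubBaseTopological.Build filter_space
  (range X_ `|` range (setC \o X_)) id.
HB.instance Definition _ := isSubBaseTopological.Build ideal_space
  (range Y_ `|` range (setC \o Y_)) id.

Definition principal_filter a : set L := [set b | le_meet a b].
Definition principal_ideal a : set L := [set b | le_join b a].

Lemma principal_filterP a : principal_filter a \in filters.
Proof.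
rewrite inE; split.
- by exists a; apply: bmeetxx.
- move=> b c ab bc; rewrite /principal_filter /= /le_meet in ab bc *.
  by rewrite -ab -bmeetA bc.
- move=> b c ab ac; rewrite /principal_filter /= /le_meet in ab ac *.
  by rewrite bmeetA ab.
Qed.

Lemma principal_idealP a : principal_ideal a \in ideals.
Proof.
rewrite inE; split.
- by exists a; apply: bjoinxx.
- move=> b c ca bc; rewrite /principal_ideal /= /le_join in ca bc *.
  by rewrite -ca bjoinA bc.
- move=> b c ba ca; rewrite /principal_ideal /= /le_join in ba ca *.
  by rewrite -bjoinA ca.
Qed.

Definition Sx a : filter_space := SigSub (principal_filterP a).
Definition Sy a : ideal_space := SigSub (principal_idealP a).

Lemma cone_Sx a : cone Sx a = X_ a.
Proof.
apply/seteqP; split=> [F /asboolP|F /= Fa]; first by apply; apply: bmeetxx.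
apply/asboolP => b ab; have [_ up _] := set_valP F; exact: up ab.
Qed.

Lemma cone_Sy a : cone Sy a = Y_ a.
Proof.
apply/seteqP; split=> [F /asboolP|F /= Fa]; first by apply; apply: bjoinxx.
apply/asboolP => b ab; have [_ down _] := set_valP F; exact: down ab.
Qed.

Lemma X_inj : injective X_.
Proof.
move=> a b eab; have h c d : X_ c = X_ d -> le_meet d c.
  move=> cd; suff : X_ c (Sx d) by [].
  by rewrite cd; apply: bmeetxx.
by rewrite -(h _ _ eab) bmeetC; apply/esym/h.
Qed.

Lemma Y_inj : injective Y_.
Proof.
move=> a b eab; have h c d : Y_ c = Y_ d -> le_join c d.
  move=> cd; suff : Y_ c (Sy d) by [].
  by rewrite cd; apply: bjoinxx.
by rewrite -(h _ _ eab) bjoinC; apply/esym/h.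
Qed.

Definition S_rho (P : set filter_space) : set ideal_space :=
  ~` Y_ ('pinv_(fun=> bzero L) setT X_ P).

Definition S_star (Q : set ideal_space) : set filter_space :=
  X_ (bneg ('pinv_(fun=> bzero L) setT (fun a => ~` Y_ a) Q)).

Lemma S_rhoE a : S_rho (X_ a) = ~` Y_ a.
Proof. by rewrite /S_rho pinvKV ?inE // => ? ? _ _; apply: X_inj. Qed.

Lemma S_starE a : S_star (~` Y_ a) = X_ (bneg a).
Proof.
have inj : {in [set: L] &, injective (fun b => ~` Y_ b)}.
  by move=> ? ? _ _ /setC_inj; apply: Y_inj.
by rewrite /S_star (pinvKV _ inj (in_setT a)).
Qed.

Definition S_of : twospace_star_data :=
  @TwospaceStarData (TwospaceData Sx Sy S_rho) S_star (~` Y_ (bzero L)).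

End Spaces.

(* Main.v *)
(* The bisemilattice is Xstar itself: meet is intersection, join is the
   transport of union along rho, and negation is star o rho.  A point x of X
   is sent to the filter of all P in Xstar containing x, and a point y of Y to
   the ideal of all P with y outside rho P.  Both cases are instances of one
   representation of an Fspace by the filters of its semilattice of cones:
   the order is recovered because points are suprema of generators, and every
   filter F comes from a point by compactness, since a cone in F is never
   covered by cones outside F -- its generator lies in none of them. *)
From HB Require Import structures.
From mathcomp Require Import all_boot all_order finmap.
From mathcomp Require Import all_classical topology.
Require Import Defs.

Set Implicit Arguments.
Unset Strict Implicit.
Unset Printing Implicit Defensive.

Import Order.TTheory.
Local Open Scope order_scope.
Local Open Scope classical_set_scope.

(** * Subbases, continuity and intersections of cones *)

Lemma subbasis_open (X : topologicalType) (S : set (set X)) V :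
  is_subbasis S -> S V -> open V.
Proof.
move=> -> SV; exists [set V]; last exact: bigcup_set1.
by move=> _ ->; exact: (finI_from1 id SV).
Qed.

(** Preimages commute with unions and with finite intersections. *)
Lemma subbasis_continuous (X Y : topologicalType) (S : set (set Y))
    (f : X -> Y) :
  is_subbasis S -> (forall V, S V -> open (f @^-1` V)) -> continuous f.
Proof.
move=> subS fS; apply/continuousP => A; rewrite subS => -[B BS <-].
rewrite preimage_bigcup; apply: bigcup_open => V /BS[D DS <-].
rewrite preimage_bigcap bigcap_fset big_seq.
by apply: big_ind => [|? ?|? /DS/set_mem/fS //]; [exact: openT|exact: openI].
Qed.

Lemma fspace_coneI d (X : POrderedTopological.type d) (I : Type) (x_ : I -> X)
    P Q : is_fspace x_ -> cones x_ P -> cones x_ Q -> cones x_ (P `&` Q).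
Proof.
move=> hX cP cQ; apply: (fspace_finI hX); apply: finI_fromI.
- exact: (finI_from1 id cP).
- exact: (finI_from1 id cQ).
Qed.

Lemma fspace_coneT d (X : POrderedTopological.type d) (I : Type) (x_ : I -> X) :
  is_fspace x_ -> cones x_ setT.
Proof.
move=> hX; apply: (fspace_finI hX); exists fset0 => //.
by rewrite set_fset0 bigcap_set0.
Qed.

(* Filters of a meet semilattice; for a join semilattice, where [op a b = a]
   means that [b] lies below [a], these are its ideals. *)
Definition op_filter (A : Type) (op : A -> A -> A) (F : set A) : Prop :=
  [/\ F !=set0,
      forall a b, F a -> op a b = a -> F b &
      forall a b, F a -> F b -> F (op a b)].

(** * Points of an Fspace as filters of its semilattice of cones *)

Section FspaceRepresentation.
Context {d : Order.disp_t} {X : POrderedTopological.type d} {I : Type}.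
Variable x_ : I -> X.
Hypothesis hX : is_fspace x_.
Variables (A : Type) (op : A -> A -> A) (phi : A -> set X).
Hypotheses (phi_cones : range phi = cones x_)
  (phi_op : forall a b, phi (op a b) = phi a `&` phi b).

Lemma phi_cone a : exists i, phi a = cone x_ i.
Proof.
by have [i _ <-] : cones x_ (phi a) by [rewrite -phi_cones; exists a]; exists i.
Qed.

Lemma cone_phi i : exists a, phi a = cone x_ i.
Proof.
by have [a _ <-] : range phi (cone x_ i) by [rewrite phi_cones; exists i];
  exists a.
Qed.

Lemma phi_clopen a : clopen (phi a).
Proof. by have [i ->] := phi_cone a; exact: fspace_clopen. Qed.

Lemma point_filter x : op_filter op [set a | phi a x].
Proof.
split=> [|a b /= ax ab|a b /= ax bx]; last by rewrite phi_op.
- have [a _ aT] : range phi setT by rewrite phi_cones; exact: fspace_coneT.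
  by exists a; rewrite /= aT.
- by move: ax; rewrite -ab phi_op => -[].
Qed.

(** If [y] lies in every cone containing [x], then [y] bounds all generators below [x], whose
    supremum is [x]. *)
Lemma le_phi x y : x <= y <-> (forall a, phi a x -> phi a y).
Proof.
split=> [xy a|xy].
  by have [i ->] := phi_cone a; move=> /= ix; exact: le_trans ix xy.
have [_ lubx] := fspace_lub hX x; apply: lubx => _ [i /= ix <-].
by have [a ai] := cone_phi i; have := xy a; rewrite ai; exact.
Qed.

Lemma filter_point F : injective phi -> op_filter op F ->
  exists x, F = [set a | phi a x].
Proof.
move=> phi_inj [[a0 Fa0] Fup FI].
(* A point lying in some [B a] with [F a] avoids every cone outside [F]; the [B a] form a base of a
   proper filter, whose cluster point is the wanted [x]. *)
pose B a := phi a `\` \bigcup_(b in ~` F) phi b.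
have BI a b : B (op a b) `<=` B a `&` B b.
  by move=> x []; rewrite phi_op => -[xa xb] xn.
have FF : ProperFilter (filter_from F B).
  apply: filter_from_proper.
    apply: filter_from_filter; first by exists a0.
    by move=> a b Fa Fb; exists (op a b); [exact: FI|exact: BI].
  (* The generator [x_ i] of [phi a] witnesses that [B a] is nonempty: if it lay in [phi b], then
     [phi a] would be contained in [phi b], so [op a b = a] and [b] would be in [F]. *)
  move=> a Fa; have [i ai] := phi_cone a; exists (x_ i).
  split=> [|[b nFb bi]]; first by rewrite ai; exact: lexx.
  apply: nFb; apply: (Fup _ _ Fa); apply: phi_inj; rewrite phi_op.
  apply/setIidPl; have [j bj] := phi_cone b.
  rewrite ai bj => x /= ix; apply: le_trans ix.
  by move: bi; rewrite bj.
have [cX _ _] := fspace_stone hX.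
have [|x [_]] := cX _ FF; first by exists a0.
(* A cluster point lies in every closed set containing some [B a] with [F a]. Both [phi a] and its
   complement are closed, which decides membership of [x] either way. *)
rewrite clusterE => clx; exists x; apply/seteqP; split=> a /= Fa.
  have [_ /closure_id ->] := phi_clopen a.
  by apply: clx; exists a => // y [].
apply: contrapT => nFa; have [opa _] := phi_clopen a.
suff : (~` phi a) x by [].
have /closure_id -> := open_closedC opa.
apply: clx; exists a0 => // y [_ yn] ay; by apply: yn; exists a.
Qed.

(** [T] is any ordered space whose points are, through [u], the filters of [op]; this covers filters
    of the meet and ideals of the join alike. Since [f] and [g] are mutually inverse, images under
    [f] are preimages under [g], so complements are preserved too. *)
Lemma fspace_filter_homeo d' (T : POrderedTopological.type d')
    (u : T -> set A) (U := fun a => [set t | u t a]) :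
  injective phi ->
  (forall s t, s <= t <-> u s `<=` u t) ->
  (forall F, op_filter op F <-> exists t, u t = F) ->
  is_subbasis (range U `|` range (setC \o U)) ->
  exists f : X -> T, [/\ order_homeo f,
    forall a, f @` phi a = U a & forall a, f @` (~` phi a) = ~` U a].
Proof.
move=> phi_inj u_le u_filter subT.
have /choice[f fE] x : exists t, u t = [set a | phi a x].
  by apply/u_filter; exact: point_filter.
have /choice[g gE] t : exists x, u t = [set a | phi a x].
  by apply: filter_point => //; apply/u_filter; exists t.
have u_inj : injective u.
  by move=> s t st; apply: le_anti; apply/andP; split; apply/u_le; rewrite st.
have gK : cancel g f by move=> t; apply: u_inj; rewrite fE -gE.
have fK : cancel f g.
  move=> x; apply: le_anti; apply/andP; split; apply/le_phi => a.
    by move=> ax; have : u (f x) a; [rewrite gE|rewrite fE].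
  by move=> ax; have : u (f x) a; [rewrite fE|rewrite gE].
have fU a : f @^-1` (U a) = phi a.
  by apply/seteqP; split=> x; rewrite /U /= fE.
have gphi a : g @^-1` (phi a) = U a.
  by apply/seteqP; split=> t; rewrite /U /= gE.
have f_image (V : set X) : f @` V = g @^-1` V.
  apply/seteqP; split=> [_ [x Vx <-]|t Vt]; first by rewrite /= fK.
  by exists (g t).
exists f; split; last 2 first.
- by move=> a; rewrite f_image gphi.
- by move=> a; rewrite f_image -preimage_setC gphi.
split.
- move=> x y; apply/idP/idP => [/u_le xy|xy].
    by apply/le_phi => a ax; have := xy a; rewrite !fE; exact.
  by apply/u_le; rewrite !fE; exact/le_phi.
- apply: (subbasis_continuous subT) => _ [[a _ <-]|[a _ <-]] /=.
    by rewrite fU; case: (phi_clopen a).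
  by rewrite -preimage_setC fU openC; case: (phi_clopen a).
- exists g; split=> //; apply: (subbasis_continuous (fspace_subbasis hX)).
  move=> _ [] [i _ <-] /=; have [a <-] := cone_phi i;
    rewrite -?preimage_setC gphi; apply: (subbasis_open subT).
  + by left; exists a.
  + by right; exists a.
Qed.

End FspaceRepresentation.

(** * The De Morgan bisemilattice of a 2space with star *)

Section DualBisemilattice.
Variable W : twospace_star_data.
Hypothesis hW : is_twospace_star W.

Local Notation rho := (trho W).
Local Notation star := (tstar W).

Let h2 := star_twospace hW.

Lemma rho_coYstar P : Xstar W P -> coYstar W (rho P).
Proof. by have [+ _ _] := twospace_bij h2; apply. Qed.

Lemma star_Xstar Q : coYstar W Q -> Xstar W (star Q).
Proof. by have [+ _ _] := star_bij hW; apply. Qed.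

Lemma rhoK P : Xstar W P -> rhoV (rho P) = P.
Proof.
have [_ inj _] := twospace_bij h2; move=> XP.
by apply: pinvKV => //; exact/mem_set.
Qed.

Lemma rhoVK Q : coYstar W Q -> rho (rhoV Q) = Q.
Proof.
have [_ _ sj] := twospace_bij h2; move=> YQ.
by apply: (surjpK _ sj); exact/mem_set.
Qed.

Lemma rhoV_Xstar Q : coYstar W Q -> Xstar W (rhoV Q).
Proof.
have [_ _ sj] := twospace_bij h2.
by move=> /sj[P XP <-]; rewrite rhoK.
Qed.

Lemma starK Q : coYstar W Q -> starV (star Q) = Q.
Proof.
by have [_ inj _] := star_bij hW; move=> YQ; apply: pinvKV => //; exact/mem_set.
Qed.

Lemma starVK P : Xstar W P -> star (starV P) = P.
Proof.
by have [_ _ sj] := star_bij hW; move=> XP; apply: (surjpK _ sj); exact/mem_set.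
Qed.

Lemma starV_coYstar P : Xstar W P -> coYstar W (starV P).
Proof.
have [_ _ sj] := star_bij hW.
by move=> /sj[Q YQ <-]; rewrite starK.
Qed.

Lemma XstarI P Q : Xstar W P -> Xstar W Q -> Xstar W (P `&` Q).
Proof. exact: fspace_coneI (twospace_X h2). Qed.

Lemma coYstarU P Q : coYstar W P -> coYstar W Q -> coYstar W (P `|` Q).
Proof.
move=> [i _ <-] [j _ <-] /=; rewrite -setCI.
have [||k _ <-] := @fspace_coneI _ _ _ _ (cone (ty W) i) (cone (ty W) j)
  (twospace_Y h2); [by exists i|by exists j|by exists k].
Qed.

(** An order-reversing bijection turns joins into meets. Union and intersection are the join and
    meet here because both families are closed under them. *)
Lemma starU P Q : coYstar W P -> coYstar W Q ->
  star (P `|` Q) = star P `&` star Q.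
Proof.
move=> YP YQ; have YPQ := coYstarU YP YQ.
apply/seteqP; split.
  by rewrite subsetI; split; apply/(star_anti hW).
have XPQ := XstarI (star_Xstar YP) (star_Xstar YQ).
rewrite -(starVK XPQ); apply/(star_anti hW) => //; first exact: starV_coYstar.
rewrite subUset; split; apply/(star_anti hW); rewrite ?starVK //;
  exact: starV_coYstar.
Qed.

Definition dual_carrier := set_type (Xstar W).
Implicit Types a b c : dual_carrier.

Definition dual_of P (XP : Xstar W P) : dual_carrier := SigSub (mem_set XP).

Definition dual_cone a : set (tX W) := set_val a.

Lemma dual_cone_inj : injective dual_cone.
Proof. exact: val_inj. Qed.

Lemma dual_coneP a : Xstar W (dual_cone a).
Proof. exact: set_valP. Qed.

Lemma rho_dual_cone a : coYstar W (rho (dual_cone a)).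
Proof. exact: rho_coYstar (dual_coneP a). Qed.

#[local] Hint Resolve dual_coneP rho_dual_cone : core.

Definition dual_meet a b := dual_of (XstarI (dual_coneP a) (dual_coneP b)).
Definition dual_join a b := dual_of (rhoV_Xstar
  (coYstarU (rho_dual_cone a) (rho_dual_cone b))).
Definition dual_neg a := dual_of (star_Xstar (rho_dual_cone a)).
Definition dual_zero := dual_of (rhoV_Xstar (star_zero hW)).
Definition dual_one := dual_of (fspace_coneT (twospace_X h2)).

Lemma dual_meetE a b : dual_cone (dual_meet a b) = dual_cone a `&` dual_cone b.
Proof. by []. Qed.

Lemma rho_dual_join a b :
  rho (dual_cone (dual_join a b)) = rho (dual_cone a) `|` rho (dual_cone b).
Proof. by apply: rhoVK; apply: coYstarU. Qed.

Lemma dual_negE a : dual_cone (dual_neg a) = star (rho (dual_cone a)).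
Proof. by []. Qed.

Lemma rho_dual_zero : rho (dual_cone dual_zero) = tzero W.
Proof. exact: rhoVK (star_zero hW). Qed.

(** Lets identities about [dual_join] be checked after applying [rho], where the join becomes plain
    union. *)
Lemma dual_rho_inj a b : rho (dual_cone a) = rho (dual_cone b) -> a = b.
Proof.
by move=> ab; apply: dual_cone_inj; rewrite -[LHS]rhoK // ab; apply: rhoK.
Qed.

Lemma dual_meetxx : idempotent_op dual_meet.
Proof. by move=> a; apply: dual_cone_inj; exact: setIid. Qed.

Lemma dual_joinxx : idempotent_op dual_join.
Proof. by move=> a; apply: dual_rho_inj; rewrite rho_dual_join setUid. Qed.

Lemma dual_meetC : commutative dual_meet.
Proof. by move=> a b; apply: dual_cone_inj; exact: setIC. Qed.

Lemma dual_joinC : commutative dual_join.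
Proof. by move=> a b; apply: dual_rho_inj; rewrite !rho_dual_join setUC. Qed.

Lemma dual_meetA : associative dual_meet.
Proof. by move=> a b c; apply: dual_cone_inj; exact: setIA. Qed.

Lemma dual_joinA : associative dual_join.
Proof. by move=> a b c; apply: dual_rho_inj; rewrite !rho_dual_join setUA. Qed.

Lemma dual_meet_joinr : right_distributive dual_meet dual_join.
Proof.
move=> a b c; apply: dual_cone_inj.
exact: (twospace_meet h2 (dual_coneP a) (dual_coneP b) (dual_coneP c)).
Qed.

Lemma dual_join_meetr : right_distributive dual_join dual_meet.
Proof.
move=> a b c; apply: dual_rho_inj.
have := twospace_join h2 (rho_dual_cone a) (rho_dual_cone b) (rho_dual_cone c).
by rewrite rho_dual_join dual_meetE !rhoK.
Qed.

Lemma dual_meetx1 : right_id dual_one dual_meet.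
Proof. by move=> a; apply: dual_cone_inj; exact: setIT. Qed.

Lemma dual_joinx0 : right_id dual_zero dual_join.
Proof.
move=> a; apply: dual_rho_inj; rewrite rho_dual_join rho_dual_zero.
by apply/setUidPl; exact: (star_zero_le hW).
Qed.

Lemma dual_negK : involutive dual_neg.
Proof.
move=> a; apply: dual_cone_inj; rewrite !dual_negE.
(* The outer [star] after [rho] becomes [rhoV] after [starV], which then cancels the inner pair. *)
rewrite (star_rho hW) ?starK ?rhoK //; exact: star_Xstar.
Qed.

Lemma dual_neg_join : {morph dual_neg : a b / dual_join a b >-> dual_meet a b}.
Proof.
by move=> a b; apply: dual_cone_inj; rewrite !dual_negE rho_dual_join starU.
Qed.

(** Follows from the law for joins by conjugating with the involution. *)
Lemma dual_neg_meet : {morph dual_neg : a b / dual_meet a b >-> dual_join a b}.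
Proof.
by move=> a b; rewrite -[RHS]dual_negK dual_neg_join !dual_negK.
Qed.

Definition dual_bisemilattice : deMorganBisemilattice :=
  DeMorganBisemilattice dual_meetxx dual_joinxx dual_meetC dual_joinC
    dual_meetA dual_joinA dual_meet_joinr dual_join_meetr dual_meetx1
    dual_joinx0 dual_negK dual_neg_meet dual_neg_join.

End DualBisemilattice.

(** * Filters and ideals as instances of [op_filter] *)

Section SpacesOfBisemilattice.
Variable L : deMorganBisemilattice.

Lemma op_filter_meetP (F : set L) :
  op_filter (@bmeet L) F <-> exists t : filter_space L, set_val t = F.
Proof.
split=> [Ff|[t <-]]; last by have [] := set_valP t; split.
by have Fs : F \in @filters L by [apply/mem_set]; exists (SigSub Fs).
Qed.

Lemma op_filter_joinP (J : set L) :
  op_filter (@bjoin L) J <-> exists t : ideal_space L, set_val t = J.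
Proof.
split=> [[J0 Jd JU]|[t <-]].
  have Js : J \in @ideals L.
    by apply/mem_set; split=> // a b Jb ab; apply: (Jd b) => //; rewrite bjoinC.
  by exists (SigSub Js).
have [J0 Jd JU] := set_valP t; split=> // a b Ja ab; apply: (Jd b a) => //.
by rewrite /le_join bjoinC.
Qed.

End SpacesOfBisemilattice.

(** * Assembling the isomorphism from its two components *)

Theorem theorem7p7 (W : twospace_star_data) (hW : is_twospace_star W) :
  exists L : deMorganBisemilattice, twospace_star_isomorphic W (S_of L).
Proof.
pose L := dual_bisemilattice hW; exists L.
pose phi (a : L) : set (tX W) := dual_cone (a : dual_carrier W).
(* Complementing [rho] yields the cones of Y and turns the union defining the join into an
   intersection, as the representation requires. *)
pose psi (a : L) : set (tY W) := ~` trho W (phi a).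
have h2 := star_twospace hW.
have phi_range : range phi = Xstar W.
  apply/seteqP; split=> [_ [a _ <-]|P XP]; first exact: set_valP.
  by exists (dual_of XP).
have rho_phi P : Xstar W P -> exists a, P = phi a.
  by rewrite -phi_range => -[a _ <-]; exists a.
have psi_phi Q : coYstar W Q -> exists a, Q = ~` psi a.
  have [_ _ sj] := twospace_bij h2.
  by move=> /sj[P /rho_phi[a ->] <-]; exists a; rewrite setCK.
have psi_coY a : coYstar W (~` psi a).
  by rewrite setCK; apply: rho_coYstar => //; exact: set_valP.
have psi_range : range psi = cones (ty W).
  apply/seteqP; split=> [_ [a _ <-]|_ [i _ <-]].
    by have [i _ /setC_inj <-] := psi_coY a; exists i.
  have [|a /setC_inj ->] := psi_phi (~` cone (ty W) i); first by exists i.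
  by exists a.
have phi_inj : injective phi by exact: dual_cone_inj.
have psi_inj : injective psi.
  by move=> a b /setC_inj; exact: dual_rho_inj.
have phi_meet a b : phi (bmeet a b) = phi a `&` phi b by [].
have psi_join a b : psi (bjoin a b) = psi a `&` psi b.
  by rewrite /psi -setCU -rho_dual_join.
have [||f [f_homeo f_phi _]] := @fspace_filter_homeo _ _ _ _ (twospace_X h2)
  _ _ _ phi_range phi_meet _ (filter_space L) set_val phi_inj _
  (@op_filter_meetP L).
- by move=> s t; split=> [/asboolP|st] //; apply/asboolP.
(* The topology of the filter space is generated by exactly this subbasis, so the claim holds by
   computation. *)
- by [].
have [||g [g_homeo g_psi g_psiC]] := @fspace_filter_homeo _ _ _ _
  (twospace_Y h2) _ _ _ psi_range psi_join _ (ideal_space L) set_val psi_inj _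
  (@op_filter_joinP L).
- by move=> s t; split=> [/asboolP|st] //; apply/asboolP.
- by [].
have rhoE a : trho W (phi a) = ~` psi a by rewrite setCK.
exists f, g; split=> //.
- apply/seteqP; split=> [_ [_ /rho_phi[a ->] <-]|_ [a _ <-]].
    by exists a => //; rewrite f_phi; exact: cone_Sx.
  exists (phi a); first by rewrite -phi_range; exists a.
  by rewrite f_phi; apply/esym; exact: cone_Sx.
- apply/seteqP; split=> [_ [_ /psi_phi[a ->] <-]|_ [a _ <-]].
    by exists a => //=; rewrite g_psiC; congr (~` _); exact: cone_Sy.
  exists (~` psi a) => //.
  by rewrite g_psiC /=; congr (~` _); apply/esym; exact: cone_Sy.
- move=> _ /rho_phi[a ->]; rewrite rhoE f_phi g_psiC; exact: S_rhoE.
(* [star] of [rho (phi a)] is by definition the cone of [bneg a]. *)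
- move=> _ /psi_phi[a ->]; rewrite g_psiC -rhoE -[tstar W _]/(phi (bneg a)).
  by rewrite f_phi; exact: S_starE.
- have -> : tzero W = ~` psi (bzero L).
    by rewrite setCK; exact/esym/(rho_dual_zero hW).
  exact: g_psiC.
Qed.
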